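(* Let $x_0\ge 0$. Define $\rho$ on $[0,\infty)$ by $$\rho(0)=\frac{1-\mu(0)}{2},\qquad \rho(x)=\sum_{k=1}^{\infty}\left(\frac{\mu(x)}{2}+\mu\bigl((x,x+k)\bigr)+\frac{\mu(x+k)}{2}\right)\mu(k)\quad\text{if } x>0 .$$ Then the restriction $\rho_{x_0}$ of $\rho$ to $C(x_0)$ (that is, $\rho_{x_0}(B)=\sum_{x\in B}\rho(x)$ for $B\subset C(x_0)$) is an invariant measure for the process of reflections $(R_k)$ on $C(x_0)$. Moreover, $\rho_{x_0}$ is the unique invariant measure of $(R_k)$ on $C(x_0)$ up to multiplication by a constant, provided that $\nu_{x_0}$ is the unique invariant measure (up to multiplication by a constant) of the reflected random walk $(X_n)$ on $C(x_0)$.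
   Context: Let $(Y_n)_{n\ge 1}$ be i.i.d. non-constant random variables with values in $\mathbb{N}_0=\{0,1,2,\dots\}$ and common distribution $\mu$. Write $\mu(x)=\mu(\{x\})$ for real $x\ge 0$, so $\mu(x)=0$ if $x\notin\mathbb{N}_0$. Reflected random walk is the Markov chain on $[0,\infty)$ given by an initial value $X_0\ge 0$ and $X_{n+1}=|X_n-Y_{n+1}|$. Put $d=\gcd\operatorname{supp}(\mu)$ and $N=\sup\operatorname{supp}(\mu)\in(0,\infty]$. For $x_0\ge0$ let $S(x_0)=\{kd\pm x_0: k\in\mathbb{Z}\}\cap[0,\infty)$ and $C(x_0)=S(x_0)\cap[0,N]$ (with $C(x_0)=S(x_0)$ if $N=\infty$). It is known that $C(x_0)$ is an essential (irreducible and absorbing) class for $(X_n)$, into which $(X_n)$ started at $x_0$ is absorbed after finitely many steps. Reflection times: $r(0)=0$ and $r(k+1)=\inf\{n>r(k): X_n=-(X_{n-1}-Y_n)\}=\inf\{n>r(k): Y_{r(k)+1}+\dots+Y_n\ge X_{r(k)}\}$; these are almost surely finite. The process of reflections is the Markov chain $R_k=X_{r(k)}$. The measure $\nu_{x_0}$ is the restriction to $C(x_0)$ of $\nu$, where $\nu(0)=\frac{1-\mu(0)}{2}$ and $\nu(x)=\frac{\mu(x)}{2}+\mu\bigl((x,\infty)\bigr)$ for $x>0$; it is known to be an invariant measure of $(X_n)$ on $C(x_0)$. Invariant measures on the denumerable set $C(x_0)$ are non-zero and give finite mass to every point; their total mass need not be finite. *)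

(* Defs.v *)
From HB Require Import structures.
From mathcomp Require Import all_boot all_order all_algebra.
From mathcomp Require Import all_classical all_reals all_analysis.

Set Implicit Arguments.
Unset Strict Implicit.
Unset Printing Implicit Defensive.

Import Order.TTheory GRing.Theory Num.Theory.
Import numFieldNormedType.Exports.

Local Open Scope classical_set_scope.
Local Open Scope ring_scope.

(* The value on set0 is 0 instead of infinity.  Below, inf_nat is only applied to
   the sets defining the reflection times, which are almost surely nonempty. *)
Definition inf_nat (A : set nat) : nat :=
  get [set n | A n /\ forall m, A m -> (n <= m)%N].

(* This d divides all the elements of A, as is seen with e = d, and every common
   divisor divides it. *)
Definition gcd_set (A : set nat) : nat :=
  get [set d | forall e, (e %| d)%N <-> (forall n, A n -> (e %| n)%N)].

Section Increments.
Context d (Omega : measurableType d) (R : realType) (P : probability Omega R).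
Variable Y : nat -> {RV P >-> nat}.

(* Every subset of nat is measurable. *)
Definition mutually_independent : Prop :=
  forall (s : seq nat) (A : nat -> set nat), uniq s ->
    P [set w | forall i, i \in s -> A i (Y i w)] =
    (\prod_(i <- s) P [set w | A i (Y i w)])%E.

Definition iid (mu : probability nat R) : Prop :=
  (forall (n : nat) (A : set nat), distribution P (Y n) A = mu A) /\
  mutually_independent.

(* The increments are numbered from 0: Y n is the (n+1)-st increment, so that
   X_(n+1) = |X_n - Y n|. *)
Fixpoint walk (x : R) (n : nat) (w : Omega) : R :=
  if n is n'.+1 then `|walk x n' w - (Y n' w)%:R| else x.

Fixpoint reflection_time (x : R) (k : nat) (w : Omega) : nat :=
  if k is k'.+1 then
    inf_nat [set n | (reflection_time x k' w < n)%N /\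
      walk x n w = - (walk x n.-1 w - (Y n.-1 w)%:R)]
  else 0%N.

Definition reflections (x : R) (k : nat) (w : Omega) : R :=
  walk x (reflection_time x k w) w.

(* A process is a family Z of trajectories, Z x n being the state at time n when
   the initial state is x. *)
Definition transition (Z : R -> nat -> Omega -> R) (x y : R) : \bar R :=
  P [set w | Z x 1%N w = y].

(* A measure on the denumerable set C is a Borel measure on R that is
   concentrated on C. *)
Definition invariant_measure (Z : R -> nat -> Omega -> R) (C : set R)
    (m : {measure set R -> \bar R}) : Prop :=
  [/\ m (~` C) = 0%E, m C != 0%E,
      forall y, C y -> (m [set y] < +oo)%E &
      forall y, C y ->
        m [set y] = (\esum_(x in C) (m [set x] * transition Z x y))%E].

Definition unique_invariant_measure (Z : R -> nat -> Omega -> R) (C : set R)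
    (m : {measure set R -> \bar R}) : Prop :=
  invariant_measure Z C m /\
  forall m' : {measure set R -> \bar R}, invariant_measure Z C m' ->
    exists2 c : R, 0 < c & forall B : set R, measurable B ->
      m' B = (c%:E * m B)%E.

End Increments.

Section Weights.
Context (R : realType).

Definition sum_measure (C : set R) (f : R -> \bar R)
    (f_ge0 : forall x, (0 <= f x)%E) (B : set R) : \bar R :=
  (\esum_(x in B `&` C) f x)%E.

Section instance.
Variables (C : set R) (f : R -> \bar R) (f_ge0 : forall x, (0 <= f x)%E).

Let sum0 : sum_measure C f_ge0 set0 = 0%E.
Proof. by rewrite /sum_measure set0I esum_set0. Qed.

Let sum_ge0 B : (0 <= sum_measure C f_ge0 B)%E.
Proof. exact: esum_ge0. Qed.

Let sum_additive : semi_sigma_additive (sum_measure C f_ge0).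
Proof.
move=> F mF tF mUF; rewrite /sum_measure setI_bigcupl esum_bigcupT//; last first.
  exact: trivIset_setIr.
rewrite -nneseries_esumT; last by move=> n; exact: esum_ge0.
by apply: is_cvg_nneseries => n _ _; exact: esum_ge0.
Qed.

HB.instance Definition _ := isMeasure.Build _ _ _ (sum_measure C f_ge0)
  sum0 sum_ge0 sum_additive.
End instance.

Variable mu : probability nat R.

Definition supp : set nat := [set n | (0 < mu [set n])%E].

(* mu as a measure on the real line. *)
Definition muR (A : set R) : \bar R := mu [set n | A n%:R].

Definition S_class (x0 : R) : set R :=
  [set x | 0 <= x /\ exists k : int,
    x = k%:~R * (gcd_set supp)%:R + x0 \/ x = k%:~R * (gcd_set supp)%:R - x0].

Definition C_class (x0 : R) : set R :=
  S_class x0 `&`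
  [set x | (x%:E <= ereal_sup [set (n%:R : R)%:E | n in supp])%E].

Definition nu (x : R) : \bar R :=
  (if x == 0%R then (1 - muR [set 0%R]) / 2%:E
   else muR [set x] / 2%:E + muR `]x, +oo[)%E.

Definition rho (x : R) : \bar R :=
  (if x == 0%R then (1 - muR [set 0%R]) / 2%:E
   else \sum_(1 <= k <oo)
     (muR [set x] / 2%:E + muR `]x, (x + k%:R)%R[ + muR [set (x + k%:R)%R] / 2%:E)
     * muR [set k%:R])%E.

Let half_ge0 (a : \bar R) : (0 <= a -> 0 <= a / 2%:E)%E.
Proof. by move=> a0; rewrite mule_ge0// inve_ge0. Qed.

Lemma nu_ge0 x : (0 <= nu x)%E.
Proof.
rewrite /nu /muR; case: ifPn => _; last by rewrite adde_ge0 ?half_ge0.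
by rewrite half_ge0// sube_ge0 ?fin_num_measure ?probability_le1.
Qed.

Lemma rho_ge0 x : (0 <= rho x)%E.
Proof.
rewrite /rho /muR; case: ifPn => _.
  by rewrite half_ge0// sube_ge0 ?fin_num_measure ?probability_le1.
by apply: nneseries_ge0 => k _ _; rewrite mule_ge0// !adde_ge0 ?half_ge0.
Qed.

Definition nu_ (x0 : R) : {measure set R -> \bar R} :=
  sum_measure (C_class x0) nu_ge0.

Definition rho_ (x0 : R) : {measure set R -> \bar R} :=
  sum_measure (C_class x0) rho_ge0.

End Weights.

(* Main.v *)
Require Import Defs.
From mathcomp Require Import all_boot all_order all_algebra.
From mathcomp Require Import all_classical all_reals all_analysis.
From mathcomp Require Import lra ring zify.
Import Order.TTheory GRing.Theory Num.Theory.
Import numFieldNormedType.Exports.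
Local Open Scope classical_set_scope.
Local Open Scope ring_scope.

Set Implicit Arguments.
Unset Strict Implicit.
Unset Printing Implicit Defensive.

(** A step of the walk from [x] by an increment [k] either descends to
    [x - k > 0] or is reflected to [k - x >= 0]. On the state space [C] the
    transition kernel of the walk is thus the sum of two kernels, [descent] and
    [reflection], and the reflection chain makes any number of descents followed
    by one reflection: its kernel is the sum over [n] of the products of the
    [n]-th power of [descent] with [reflection] ([transition_reflections]). This
    rests on the independence of each increment from the sum of the previous
    ones, and on the fact that these sums tend to infinity almost surely, so
    that a reflection does occur.

    Write [f a] and [f b] for the images of a mass function [f] on [C] by
    [descent] and [reflection]. Two identities relate the given weights:
    [nu = rho + nu a] ([nu_balance]) and [rho = nu b] ([rho_act_reflection]).
    Both are equalities between averages over two independent increments.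
    Iterating the first one gives [nu = rho + rho a + rho a^2 + ...], because
    the remainder [nu a^n] tends to [0] ([nu_descent_vanishes]). Hence one step
    of the reflection chain maps [rho] to [nu b = rho].

    Conversely, let [f] be invariant for the reflection chain and put
    [g = f + f a + f a^2 + ...]. Then [g = f + g a], and [g b = f] is the
    invariance of [f], so [g = g a + g b] is invariant for the walk. It is
    finite because each [x] in [C] can be reflected into some [y] in [C], where
    [g b = f] is finite. If [nu] is the only invariant measure of the walk, then
    [g = c nu], and therefore [f = g b = c (nu b) = c rho]. *)

(** * Sums of nonnegative families *)

Section NonnegativeSums.
Context {R : realType}.
Local Open Scope ereal_scope.

Lemma exchange_esum {T U : choiceType} (I : set T) (J : set U)
    (a : T -> U -> \bar R) :
  (forall i j, 0 <= a i j) ->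
  \esum_(i in I) \esum_(j in J) a i j = \esum_(j in J) \esum_(i in I) a i j.
Proof.
move=> a0; rewrite !esum_esum//.
apply: (@reindex_esum _ _ _ _ _ (fun p : U * T => (p.2, p.1))); split => //.
- by move=> [u t] [/= ? ?]; split.
- by move=> [u t] [u' t'] _ _ /= [-> ->].
- by move=> [t u] [/= ? ?]; exists (u, t).
Qed.

Lemma ge_esum_elem {T : choiceType} (I : set T) (f : T -> \bar R) x :
  I x -> f x <= \esum_(i in I) f i.
Proof.
move=> Ix; apply: esum_ge; exists [set x]; last by rewrite fsbig_set1.
by split => // i ->.
Qed.

Lemma esumZl {T : choiceType} (I : set T) (c : \bar R) (f : T -> \bar R) :
  0 <= c -> (forall i, 0 <= f i) ->
  \esum_(i in I) (c * f i) = c * \esum_(i in I) f i.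
Proof.
have le_fin (b : R) (g : T -> \bar R) : (0 <= b)%R -> (forall i, 0 <= g i) ->
    \esum_(i in I) (b%:E * g i) <= b%:E * \esum_(i in I) g i.
  move=> b0 g0; apply: ge_ereal_sup => _ [X [finX XI] <-].
  rewrite -ge0_mule_fsumr//; apply: lee_wpmul2l; first by rewrite lee_fin.
  by apply: esum_ge; exists X.
case: c => [c| |//] c0 f0; last first.
  have [f_eq0|/existsNP[i /not_implyP[Ii /eqP fi]]] :=
      pselect (forall i, I i -> f i = 0).
    by rewrite !esum1 ?mule0// => i /f_eq0 ->; rewrite mule0.
  have fi0 : 0 < f i by rewrite lt_def fi f0.
  rewrite [RHS]gt0_mulye; last exact: lt_le_trans fi0 (ge_esum_elem _ Ii).
  apply/eqP; rewrite -leye_eq.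
  have := @ge_esum_elem _ I (fun i => +oo * f i) _ Ii.
  by rewrite [leLHS]gt0_mulye.
move: c0; rewrite lee_fin le_eqVlt => /predU1P[<-|c0].
  by rewrite mul0e esum1// => i _; rewrite mul0e.
apply/eqP; rewrite eq_le le_fin//= ?(ltW c0)//.
rewrite -lee_pdivlMl// (le_trans _ (le_fin c^-1%R _ _ _))//.
- by apply: le_esum => i Ii; rewrite muleA -EFinM mulVf ?mul1e// gt_eqF.
- by rewrite invr_ge0 ltW.
- by move=> i; rewrite mule_ge0// lee_fin ltW.
Qed.

Lemma esumZr {T : choiceType} (I : set T) (c : \bar R) (f : T -> \bar R) :
  0 <= c -> (forall i, 0 <= f i) ->
  \esum_(i in I) (f i * c) = (\esum_(i in I) f i) * c.
Proof.
by move=> c0 f0; rewrite muleC -esumZl//; apply: eq_esum => i _; rewrite muleC.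
Qed.

(** A family carried by a sequence of states: it turns sums over the states
    into sums over the sizes of an increment. *)
Lemma esum_along {T : choiceType} (e : nat -> T) (I : set T) (f : T -> \bar R) :
  injective e -> (forall t, I t -> f t != 0 -> exists k, t = e k) ->
  \esum_(t in I) f t = \esum_(k in [set k | I (e k)]) f (e k).
Proof.
move=> inje fe; rewrite -(@esum_image _ _ _ _ e f) => [|k l _ _]; last exact: inje.
rewrite esum_mkcond [RHS]esum_mkcond; apply: eq_esum => t _.
have [/set_mem It|nIt] := boolP (t \in I); last first.
  case: ifPn => // /set_mem[k Ik ekt]; case/negP: nIt.
  by rewrite -ekt; exact: mem_set.
case: ifPn => // /negP nt; apply/eqP/negPn/negP => /(fe _ It)[k tk].
by apply: nt; apply/mem_set; exists k; rewrite //= -tk.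
Qed.

End NonnegativeSums.

(** * Chains watched at the steps of a second kernel *)

Section WatchedChain.
Context {R : realType} {T : choiceType} (C : set T).
Local Open Scope ereal_scope.
Implicit Types (f g : T -> \bar R) (a b : T -> T -> \bar R).

Definition act f a (y : T) : \bar R := \esum_(x in C) (f x * a x y).

Definition compose a b (x y : T) : \bar R := \esum_(z in C) (a x z * b z y).

Fixpoint power a n (x y : T) : \bar R :=
  if n is n'.+1 then compose (power a n') a x y else ((x == y)%:R)%:E.

Definition potential a f (y : T) : \bar R :=
  \esum_(n in [set: nat]) act f (power a n) y.

Section Theory.
Variable a : T -> T -> \bar R.
Hypothesis a_ge0 : forall x y, 0 <= a x y.

Lemma act_ge0 f b y : (forall x, 0 <= f x) -> (forall x y, 0 <= b x y) ->
  0 <= act f b y.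
Proof. by move=> f0 b0; apply: esum_ge0 => x _; exact: mule_ge0. Qed.

Lemma power_ge0 n x y : 0 <= power a n x y.
Proof.
elim: n x y => [|n IHn] x y /=; first by rewrite lee_fin.
by apply: esum_ge0 => z _; exact: mule_ge0.
Qed.

Lemma act_power_ge0 f n y : (forall x, 0 <= f x) -> 0 <= act f (power a n) y.
Proof. by move=> f0; apply: act_ge0 => // *; exact: power_ge0. Qed.

Lemma potential_ge0 f y : (forall x, 0 <= f x) -> 0 <= potential a f y.
Proof. by move=> f0; apply: esum_ge0 => n _; exact: act_power_ge0. Qed.

Lemma eq_act f g b y : (forall x, C x -> f x = g x) -> act f b y = act g b y.
Proof. by move=> fg; apply: eq_esum => x Cx; rewrite fg. Qed.

Lemma act_compose f b c y : (forall x, 0 <= f x) ->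
    (forall x y, 0 <= b x y) -> (forall x y, 0 <= c x y) ->
  act f (compose b c) y = act (act f b) c y.
Proof.
move=> f0 b0 c0; rewrite /act /compose.
under eq_esum => x Cx.
  rewrite -esumZl//; last by move=> z; exact: mule_ge0.
  over.
rewrite exchange_esum; last by move=> *; rewrite !mule_ge0.
apply: eq_esum => z Cz; rewrite -esumZr//; last by move=> *; exact: mule_ge0.
by apply: eq_esum => x _; rewrite muleA.
Qed.

Lemma act_power0 f y : (forall x, 0 <= f x) -> C y -> act f (power a 0) y = f y.
Proof.
move=> f0 Cy; rewrite /act (esumID [set y]); last first.
  by move=> x _; rewrite mule_ge0//= lee_fin.
rewrite (_ : C `&` [set y] = [set y]); last first.
  by apply/seteqP; split => [x []//|x ->].
rewrite esum_set1/= ?eqxx ?mule1// esum1 ?adde0// => x [_ /= /eqP/negbTE ->].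
by rewrite mule0.
Qed.

Lemma act_powerS f n y : (forall x, 0 <= f x) ->
  act f (power a n.+1) y = act (act f (power a n)) a y.
Proof. by move=> f0; rewrite -act_compose//; exact: power_ge0. Qed.

Lemma act_potential f b y : (forall x, 0 <= f x) -> (forall x y, 0 <= b x y) ->
  act (potential a f) b y =
  \esum_(n in [set: nat]) act (act f (power a n)) b y.
Proof.
move=> f0 b0; rewrite /act /potential; under eq_esum => x Cx.
  rewrite -esumZr//; last by move=> n; exact: act_power_ge0.
  over.
rewrite exchange_esum// => x n; rewrite mule_ge0//; exact: act_power_ge0.
Qed.

Lemma potential_rec f y : (forall x, 0 <= f x) -> C y ->
  potential a f y = f y + act (potential a f) a y.
Proof.
move=> f0 Cy; have g0 n : 0 <= act f (power a n) y by exact: act_power_ge0.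
rewrite act_potential// /potential -!nneseries_esumT//; last first.
  by move=> n; apply: act_ge0 => // x; exact: act_power_ge0.
rewrite nneseries_recl// act_power0//; congr (_ + _).
rewrite -(nneseries_addn 1)//; apply: eq_eseriesr => n _.
by rewrite addn1 act_powerS.
Qed.

Lemma actD f g b y : (forall x, 0 <= f x) -> (forall x, 0 <= g x) ->
    (forall x y, 0 <= b x y) ->
  act (fun x => f x + g x) b y = act f b y + act g b y.
Proof.
move=> f0 g0 b0; rewrite -esumD; last 2 first.
- by move=> x _; exact: mule_ge0.
- by move=> x _; exact: mule_ge0.
by apply: eq_esum => x _; rewrite ge0_muleDl.
Qed.

(** Iterating the equation [n] times leaves the remainder [act f (power a n)],
    whose vanishing makes [f] equal to the potential of [g]. *)
Lemma potential_unique f g y : (forall x, 0 <= f x) -> (forall x, 0 <= g x) ->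
    (forall x, C x -> f x = g x + act f a x) -> C y ->
    (forall e : R, (0 < e)%R -> exists n, act f (power a n) y <= e%:E) ->
  potential a g y = f y.
Proof.
move=> f0 g0 fE Cy rem.
have step n z : C z ->
    act f (power a n) z = act g (power a n) z + act f (power a n.+1) z.
  elim: n z => [|n IHn] z Cz.
    rewrite act_powerS// !act_power0// fE//; congr (_ + _).
    by apply: eq_act => x Cx; rewrite act_power0.
  rewrite act_powerS// (eq_act _ _ IHn) actD ?act_powerS// => x;
    exact: act_power_ge0.
have iter n :
    f y = \sum_(0 <= k < n) act g (power a k) y + act f (power a n) y.
  elim: n => [|n IHn]; first by rewrite big_nil add0e act_power0.
  by rewrite IHn step// addeA big_nat_recr.
have g_ge0 n : 0 <= act g (power a n) y by exact: act_power_ge0.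
rewrite /potential -nneseries_esumT//; apply/eqP; rewrite eq_le; apply/andP.
split.
  apply: lime_le; first exact: is_cvg_nneseries.
  by apply: nearW => n; rewrite (iter n) leeDl// act_power_ge0.
apply/lee_addgt0Pr => e /rem[n le_e]; rewrite (iter n) leeD//.
exact: nneseries_lim_ge.
Qed.

(** The kernel of the chain with steps from [a] or [b], observed only just after
    its steps from [b]. *)
Definition watched b (x y : T) : \bar R :=
  \esum_(n in [set: nat]) compose (power a n) b x y.

(** Distributing [f] over the number of [a]-steps collects them in the potential
    of [a]. *)
Lemma act_watched f b y : (forall x, 0 <= f x) -> (forall x y, 0 <= b x y) ->
  act f (watched b) y = act (potential a f) b y.
Proof.
move=> f0 b0; rewrite act_potential// /watched {1}/act.
have c0 n x : 0 <= compose (power a n) b x y.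
  by apply: esum_ge0 => z _; rewrite mule_ge0// power_ge0.
under eq_esum => x Cx.
  rewrite -esumZl//.
  over.
rewrite exchange_esum; last by move=> x n; exact: mule_ge0.
by apply: eq_esum => n _; rewrite -[LHS]/(act _ _ _) act_compose//; exact: power_ge0.
Qed.

End Theory.
End WatchedChain.

(** * Partial sums of the increments *)

Section PartialSums.
Context d (Omega : measurableType d) (R : realType) (P : probability Omega R).
Variables (Y : nat -> {RV P >-> nat}) (mu : probability nat R).
Hypothesis Yiid : iid Y mu.

Definition psum (n : nat) (w : Omega) : nat := (\sum_(i < n) Y i w)%N.

Lemma psumS n w : psum n.+1 w = (psum n w + Y n w)%N.
Proof. by rewrite /psum big_ord_recr. Qed.

Lemma psum_homo w : {homo psum^~ w : m n / (m <= n)%N}.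
Proof.
by apply: homo_leq => //; [exact: leq_trans|move=> n; rewrite psumS leq_addr].
Qed.

Lemma measurable_increment n (A : set nat) : measurable [set w | A (Y n w)].
Proof. exact: measurable_funPTI. Qed.

Lemma psumS_event n (D : nat -> set nat) :
  [set w | D (Y n w) (psum n w)] =
  \bigcup_j ([set w | D j (psum n w)] `&` [set w | Y n w = j]).
Proof.
apply/seteqP; split => w /=; first by move=> ?; exists (Y n w).
by move=> [j _ [/= ? ->]].
Qed.

Lemma measurable_psum_increment n (D : nat -> set nat) :
  measurable [set w | D (Y n w) (psum n w)].
Proof.
elim: n D => [|n IHn] D; rewrite psumS_event; apply: bigcup_measurable => j _;
  apply: measurableI; try exact: (measurable_increment _ [set j]).
  have [D0|D0] := pselect (D j 0%N).
    rewrite (_ : [set w | _] = setT)//; apply/seteqP; split => // w _ /=.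
    by rewrite /psum big_ord0.
  rewrite (_ : [set w | _] = set0)//; apply/seteqP; split => // w /=.
  by rewrite /psum big_ord0.
rewrite (_ : [set w | _] = [set w | D j (psum n w + Y n w)%N]); last first.
  by apply/seteqP; split => w /=; rewrite psumS.
exact: (IHn (fun k m => D j (m + k)%N)).
Qed.

Lemma measurable_psum n (D : set nat) : measurable [set w | D (psum n w)].
Proof. exact: (measurable_psum_increment n (fun=> D)). Qed.

Lemma increment_law n (A : set nat) : P [set w | A (Y n w)] = mu A.
Proof. by rewrite -(Yiid.1 n A). Qed.

Lemma psum_increment_split n (D : nat -> set nat) (B : set Omega) :
  measurable B ->
  P ([set w | D (Y n w) (psum n w)] `&` B) =
  (\esum_(j in [set: nat])
    P ([set w | D j (psum n w)] `&` ([set w | Y n w = j] `&` B)))%E.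
Proof.
move=> mB; rewrite psumS_event setI_bigcupl measure_bigcup//; last 2 first.
- move=> j _; rewrite -setIA; apply: measurableI; first exact: measurable_psum.
  by apply: measurableI => //; exact: (measurable_increment _ [set j]).
- by move=> i j _ _ [w [/= [[_ /= <-] _] [[_ /= <-] _]]].
rewrite nneseries_esum//.
by rewrite set_mem_set; apply: eq_esum => j _; rewrite setIA.
Qed.

(** The partial sum [psum n] depends on the first [n] increments only.  The
    event about the later increments makes the induction on [n] go through:
    the value of [Y n] is moved from the sum to the list. *)
Lemma psum_independent n (D : set nat) (s : seq nat) (A : nat -> set nat) :
  uniq s -> (forall i, i \in s -> (n <= i)%N) ->
  P ([set w | D (psum n w)] `&` [set w | forall i, i \in s -> A i (Y i w)]) =
  (P [set w | D (psum n w)] * \prod_(i <- s) mu (A i))%E.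
Proof.
elim: n D s A => [|n IHn] D s A us ns.
  have prodE : P [set w | forall i, i \in s -> A i (Y i w)] =
      (\prod_(i <- s) mu (A i))%E.
    by rewrite Yiid.2//; apply: eq_bigr => i _; exact: increment_law.
  have [D0|D0] := pselect (D 0%N).
    rewrite (_ : [set w | D _] = setT); last first.
      by apply/seteqP; split => // w _ /=; rewrite /psum big_ord0.
    by rewrite setTI prodE probability_setT mul1e.
  rewrite (_ : [set w | D _] = set0); last first.
    by apply/seteqP; split => // w /=; rewrite /psum big_ord0.
  by rewrite set0I measure0 mul0e.
have step t : uniq t -> (forall i, i \in t -> (n < i)%N) ->
    P ([set w | D (psum n.+1 w)] `&`
       [set w | forall i, i \in t -> A i (Y i w)]) =
    ((\esum_(j in [set: nat])
        (P [set w | D (psum n w + j)%N] * mu [set j])) *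
     \prod_(i <- t) mu (A i))%E.
  move=> ut nt; set B := [set w | forall i, _].
  have mB : measurable B.
    rewrite (_ : B = \bigcap_(i in [set` t]) [set w | A i (Y i w)])//.
    by apply: fin_bigcap_measurable => // i _; exact: measurable_increment.
  rewrite (_ : [set w | D _] = [set w | D (psum n w + Y n w)%N]); last first.
    by apply/seteqP; split => w /=; rewrite psumS.
  rewrite (psum_increment_split n (fun j m => D (m + j)%N) mB) -esumZr//.
  - apply: eq_esum => j _.
    have nNt : n \notin t by apply/negP => /nt; rewrite ltnn.
    pose A' i := if i == n then [set j] else A i.
    have eqA' i : i \in t -> A' i = A i.
      by rewrite /A'; case: eqP => // ->; rewrite (negbTE nNt).
    rewrite (_ : _ `&` B = [set w | forall i, i \in n :: t -> A' i (Y i w)]).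
      rewrite (IHn (fun m => D (m + j)%N)) ?big_cons/= ?nNt//; last first.
        by move=> i; rewrite inE => /predU1P[->//|/nt/ltnW].
      rewrite {1}/A' eqxx muleA; congr (_ * _)%E.
      by apply: eq_big_seq => i /eqA' ->.
    apply/seteqP; split => w /=.
      move=> [Ynj Bw] i; rewrite inE => /predU1P[->|it]; first by rewrite /A' eqxx.
      by rewrite eqA'//; exact: Bw.
    move=> H; split; first by have := H n (mem_head _ _); rewrite /A' eqxx.
    by move=> i it; have := H i; rewrite inE it orbT eqA'//; apply.
  - by apply: prode_ge0.
  - by move=> j; rewrite mule_ge0.
rewrite step//; have := step [::] isT; rewrite big_nil mule1 => <- //.
by rewrite (_ : [set w | forall i, i \in [::] -> _] = setT) ?setIT//; exact/seteqP.
Qed.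

Lemma psum_increment_indep n (D A : set nat) :
  P ([set w | D (psum n w)] `&` [set w | A (Y n w)]) =
  (P [set w | D (psum n w)] * mu A)%E.
Proof.
have := @psum_independent n D [:: n] (fun=> A) isT.
rewrite big_cons big_nil mule1 => <-; last by move=> i; rewrite inE => /eqP ->.
congr (P (_ `&` _)); apply/seteqP; split => w /=.
  by move=> ? i; rewrite inE => /eqP ->.
by apply; exact: mem_head.
Qed.

Lemma psum_increment_law n (D : nat -> set nat) :
  P [set w | D (Y n w) (psum n w)] =
  (\esum_(j in [set: nat]) (P [set w | D j (psum n w)] * mu [set j]))%E.
Proof.
rewrite -[X in P X]setIT psum_increment_split//; apply: eq_esum => j _.
by rewrite setIT; exact: (psum_increment_indep n (D j) [set j]).
Qed.

(** [L] consecutive increments vanish with probability [mu [set 0] ^+ L], which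
    tends to [0] as [L] grows. *)
Lemma increments_vanish_null N : mu [set 0%N] != 1%E ->
  P [set w | forall i, (N <= i)%N -> Y i w = 0%N] = 0%E.
Proof.
move=> mu0; set Z := [set w | _].
have mZ : measurable Z.
  rewrite (_ : Z = \bigcap_(i in [set i | (N <= i)%N]) [set w | Y i w = 0%N])//.
  by apply: bigcap_measurableType => // i _; exact: (measurable_increment _ [set 0%N]).
pose p := fine (mu [set 0%N]).
have muE : mu [set 0%N] = p%:E by rewrite fineK// fin_num_measure.
have p0 : 0 <= p by rewrite fine_ge0.
have p1 : p < 1.
  rewrite lt_neqAle -lee_fin -muE probability_le1// andbT.
  by apply: contra mu0 => /eqP p1; rewrite muE p1.
have le_pow L : (P Z <= (p ^+ L)%:E)%E.
  have -> : (p ^+ L)%:E = (\prod_(i <- iota N L) mu [set 0%N])%E.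
    rewrite muE big_const_seq count_predT size_iota.
    by elim: L => //= L <-; rewrite exprS EFinM.
  have -> : (\prod_(i <- iota N L) mu [set 0%N] =
      P [set w | forall i, i \in iota N L -> [set 0%N] (Y i w)])%E.
    rewrite (Yiid.2 (iota N L) (fun=> [set 0%N])) ?iota_uniq//; apply: eq_bigr => i _.
    by rewrite increment_law.
  apply: le_measure; rewrite ?inE//.
    rewrite (_ : [set w | _] =
      \bigcap_(i in [set` iota N L]) [set w | Y i w = 0%N])//.
    apply: fin_bigcap_measurable => // i _.
    exact: (measurable_increment _ [set 0%N]).
  by move=> w Zw i; rewrite mem_iota => /andP[Ni _]; exact: Zw.
apply/eqP; rewrite eq_le measure_ge0 andbT.
have PZ : P Z = (fine (P Z))%:E by rewrite fineK// fin_num_measure.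
have cvgp : p ^+ n @[n --> \oo] --> (0 : R).
  by apply: cvg_expr; rewrite ger0_norm.
rewrite PZ lee_fin -(cvg_lim _ cvgp)//; apply: limr_ge.
  by apply/cvg_ex; exists 0.
by apply: nearW => n; rewrite -lee_fin -PZ.
Qed.

(** The partial sums stay bounded only if the increments eventually vanish. *)
Lemma psum_bounded_null m : mu [set 0%N] != 1%E ->
  P [set w | forall n, (psum n w <= m)%N] = 0%E.
Proof.
move=> mu0; apply/eqP; rewrite eq_le measure_ge0 andbT.
pose Z N := [set w | forall i, (N <= i)%N -> Y i w = 0%N].
have mZ N : measurable (Z N).
  rewrite (_ : Z N = \bigcap_(i in [set i | (N <= i)%N]) [set w | Y i w = 0%N])//.
  by apply: bigcap_measurableType => // i _; exact: (measurable_increment _ [set 0%N]).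
have Znull : P (\bigcup_N Z N) = 0%E.
  apply/negligibleP; first exact: bigcupT_measurable.
  apply: negligible_bigcup => N; apply/negligibleP => //.
  exact: increments_vanish_null.
rewrite -Znull; apply: le_measure; rewrite ?inE//.
- rewrite (_ : [set w | _] = \bigcap_n [set w | (psum n w <= m)%N]).
    apply: bigcapT_measurable => n.
    exact: (measurable_psum n [set k | (k <= m)%N]).
  by apply/seteqP; split => w H n; [move=> _; exact: (H n)|exact: (H n I)].
- exact: bigcupT_measurable.
move=> w Hw; pose val k := `[< exists n, psum n w = k >].
have ex_val : exists k, val k by exists (psum 0 w); apply/asboolP; exists 0%N.
have val_le k : val k -> (k <= m)%N by move=> /asboolP[n <-]; exact: Hw.
have [k /asboolP[N <-] kmax] := ex_maxnP ex_val val_le.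
exists N => // i Ni.
have := kmax (psum i.+1 w) (introT (asboolP _) (ex_intro _ i.+1 erefl)).
have := psum_homo w Ni; rewrite psumS; lia.
Qed.

Lemma psum_small_prob (m : nat) (e : R) : mu [set 0%N] != 1%E -> 0 < e ->
  exists n, (P [set w | (psum n.+1 w <= m)%N] < e%:E)%E.
Proof.
move=> mu0 e0; pose F n := [set w | (psum n w <= m)%N].
have mF n : measurable (F n) by exact: (measurable_psum n [set k | (k <= m)%N]).
have capF : \bigcap_n F n = [set w | forall n, (psum n w <= m)%N].
  by apply/seteqP; split => w H n; [exact: (H n I)|move=> _; exact: (H n)].
have cvgF : P (F n) @[n --> \oo] --> 0%E.
  rewrite -(psum_bounded_null m mu0) -capF; apply: nonincreasing_cvg_mu => //.
  - by rewrite (le_lt_trans (probability_le1 _ _))// ltry.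
  - by apply: bigcapT_measurable.
  - move=> i j ij; apply/subsetPset => w; exact: (leq_trans (psum_homo w ij)).
have [N _ HN] : \forall n \near \oo, (P (F n) < e%:E)%E.
  by apply: (cvgF [set x | (x < e%:E)%E]); exact: (@nbhs_open_ereal_lt _ 0 (fun=> e)).
by exists N; apply: HN; exact: leqnSn.
Qed.
End PartialSums.

(** * The weights [nu] and [rho] as averages over the increments *)

Section Weights.
Context (R : realType) (mu : probability nat R).
Local Open Scope ereal_scope.

Definition average (f : nat -> \bar R) : \bar R :=
  \esum_(k in [set: nat]) (f k * mu [set k]).

Lemma average_ge0 f : (forall k, 0 <= f k) -> 0 <= average f.
Proof. by move=> f0; apply: esum_ge0 => k _; exact: mule_ge0. Qed.

Lemma eq_average f g : (forall k, f k = g k) -> average f = average g.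
Proof. by move=> fg; apply: eq_esum => k _; rewrite fg. Qed.

Lemma averageD f g : (forall k, 0 <= f k) -> (forall k, 0 <= g k) ->
  average (fun k => f k + g k) = average f + average g.
Proof.
move=> f0 g0; rewrite -esumD; last 2 first.
- by move=> k _; exact: mule_ge0.
- by move=> k _; exact: mule_ge0.
by apply: eq_esum => k _; rewrite ge0_muleDl.
Qed.

Lemma averageZ (c : \bar R) f : 0 <= c -> (forall k, 0 <= f k) ->
  average (fun k => c * f k) = c * average f.
Proof.
move=> c0 f0; rewrite -esumZl//; last by move=> k; exact: mule_ge0.
by apply: eq_esum => k _; rewrite muleA.
Qed.

Lemma average_interchange (f : nat -> nat -> \bar R) :
  (forall k j, 0 <= f k j) ->
  average (fun k => average (f k)) = average (fun j => average (f^~ j)).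
Proof.
move=> f0; rewrite /average.
under eq_esum => k _.
  rewrite -esumZr//; last by move=> j; exact: mule_ge0.
  over.
rewrite exchange_esum; last by move=> *; rewrite !mule_ge0.
apply: eq_esum => j _; rewrite -esumZr//; last by move=> k; exact: mule_ge0.
by apply: eq_esum => k _; rewrite muleAC.
Qed.

Lemma average_ge_elem f k : f k * mu [set k] <= average f.
Proof. exact: (@ge_esum_elem _ _ _ (fun k => f k * mu [set k])). Qed.

Lemma average_indic (A : set nat) :
  average (fun k => ((k \in A)%:R)%:E) = mu A.
Proof.
have AE : A = \bigcup_(k in A) [set k].
  by apply/seteqP; split => [k Ak|k [j Aj /= ->]//]; exists k.
rewrite [in RHS]AE measure_bigcup//; last by move=> i j _ _ [k [-> ->]].
rewrite nneseries_esum//.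
rewrite set_mem_set [RHS]esum_mkcond; apply: eq_esum => k _.
by case: ifP => _; rewrite ?mul1e ?mul0e.
Qed.

Lemma average_cst (c : \bar R) : 0 <= c -> average (fun=> c) = c.
Proof.
move=> c0; rewrite -[in LHS](mule1 c) averageZ//.
rewrite -[RHS]mule1; congr (_ * _).
rewrite -[RHS](@probability_setT _ _ _ mu) -average_indic.
by apply: eq_average => k; rewrite in_setT.
Qed.

Lemma muR_average (A : set R) :
  muR mu A = average (fun j => ((j%:R \in A)%:R)%:E).
Proof.
rewrite /muR -average_indic; apply: eq_average => k.
by congr ((nat_of_bool _)%:R)%:E; apply/idP/idP => /set_mem ?; exact/mem_set.
Qed.

Lemma muR_natr k : muR mu [set k%:R] = mu [set k].
Proof.
rewrite /muR; congr (mu _); apply/seteqP; split => j /=; last by move=> ->.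
by move/eqP; rewrite eqr_nat => /eqP.
Qed.

Definition nu_weight (x : R) (j : nat) : R :=
  (if x == 0 then (0 < j)%N%:R / 2
   else (j%:R == x)%:R / 2 + (x < j%:R)%R%:R)%R.

Definition rho_weight (x : R) (k j : nat) : R :=
  (if (0 < k)%N then
     (j%:R == x)%:R / 2 + (x < j%:R < x + k%:R)%R%:R + (j%:R == x + k%:R)%:R / 2
   else 0)%R.

Lemma nu_weight_ge0 x j : (0 <= nu_weight x j)%R.
Proof. by rewrite /nu_weight; case: ifP => _; rewrite ?addr_ge0 ?divr_ge0. Qed.

Lemma rho_weight_ge0 x k j : (0 <= rho_weight x k j)%R.
Proof. by rewrite /rho_weight; case: ifP => _; rewrite ?addr_ge0 ?divr_ge0. Qed.

Lemma half_muR (A : set R) :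
  muR mu A / 2%:E = average (fun j => ((j%:R \in A)%:R / 2)%R%:E).
Proof.
rewrite muR_average inver pnatr_eq0/= muleC -averageZ ?lee_fin//.
by apply: eq_average => j; rewrite mulrC EFinM.
Qed.

Lemma nu0E : (1 - muR mu [set 0%R]) / 2%:E =
  average (fun j => ((0 < j)%N%:R / 2)%R%:E).
Proof.
rewrite (_ : 1 - muR mu [set 0%R] = muR mu (~` [set 0%R])).
  rewrite half_muR; apply: eq_average => j; congr ((nat_of_bool _)%:R / 2)%R%:E.
  by rewrite in_setC in_set1 pnatr_eq0 lt0n.
by rewrite /muR -probability_setC.
Qed.

Lemma nuE x : nu mu x = average (fun j => (nu_weight x j)%:E).
Proof.
rewrite /nu /nu_weight; case: ifP => _; first exact: nu0E.
rewrite half_muR muR_average -averageD; last 2 first.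
- by move=> k; rewrite lee_fin divr_ge0.
- by move=> k; rewrite lee_fin.
by apply: eq_average => j; rewrite in_set1 mem_setE in_itv/= andbT.
Qed.

Lemma rhoE x : x != 0%R ->
  rho mu x = average (fun k => average (fun j => (rho_weight x k j)%:E)).
Proof.
move=> /negbTE x0; rewrite /rho x0 eseries_cond eseries_mkcond nneseries_esumT.
  apply: eq_esum => k _; rewrite /rho_weight andTb.
  have [k0|_] := ltnP 0 k; last first.
    by rewrite /average esum1 ?mul0e// => j _; rewrite mul0e.
  rewrite muR_natr !half_muR muR_average -!averageD; last 4 first.
  - by move=> j; rewrite lee_fin addr_ge0 ?divr_ge0.
  - by move=> j; rewrite lee_fin divr_ge0.
  - by move=> j; rewrite lee_fin divr_ge0.
  - by move=> j; rewrite lee_fin.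
  congr (_ * _); apply: eq_average => j.
  by rewrite !in_set1 mem_setE in_itv/=.
move=> k; case: ifP => // _; rewrite mule_ge0// !adde_ge0// half_muR.
- by apply: average_ge0 => j; rewrite lee_fin divr_ge0.
- by apply: average_ge0 => j; rewrite lee_fin divr_ge0.
Qed.

Lemma rho0E : rho mu 0 = average (fun j => ((0 < j)%N%:R / 2)%R%:E).
Proof. by rewrite /rho eqxx nu0E. Qed.

(** For each size [k], the weights cut the half-line above [y] at [y + k], the
    ends being counted by halves: [rho_weight y k + nu_weight (y + k)] is
    [nu_weight y]. *)
Lemma nu_rho_balance (y : R) : (0 < y)%R ->
  nu mu y = rho mu y + average (fun k => nu mu (y + k%:R)).
Proof.
move=> y0; rewrite rhoE ?gt_eqF//.
have w0 k j : 0 <= (rho_weight y k j)%:E by rewrite lee_fin rho_weight_ge0.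
rewrite -averageD; last 2 first.
- by move=> k; exact: average_ge0.
- by move=> k; exact: nu_ge0.
rewrite -[LHS]average_cst ?nu_ge0//; apply: eq_average => k.
rewrite !nuE -averageD//; last by move=> j; rewrite lee_fin nu_weight_ge0.
apply: eq_average => j; rewrite -EFinD; congr EFin.
rewrite /nu_weight /rho_weight.
have -> : (y == 0)%R = false by rewrite gt_eqF.
have -> : (y + k%:R == 0)%R = false by rewrite gt_eqF// ltr_wpDr.
have [->|k0] := posnP k; first by rewrite addr0 add0r.
have k0' : (0 < k%:R :> R)%R by rewrite ltr0n.
have yk : (y < y + k%:R)%R by rewrite ltrDl.
case: (ltgtP j%:R y) => [jy|jy|->].
- have -> : (j%:R == y + k%:R)%R = false by rewrite lt_eqF// (lt_trans jy).
  have -> : (y + k%:R < j%:R)%R = false by apply/negbTE; rewrite -leNgt; lra.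
  by move=> /=; lra.
- case: (ltgtP j%:R (y + k%:R)%R) => /= _; lra.
- by rewrite lt_eqF//= ltNge (ltW yk)/=; lra.
Qed.

(** A step from [k - y] by an increment of size [k] is reflected into [y]. For
    [y > 0] the two double averages agree after exchanging the roles of the two
    increments. For [y = 0] they agree only once each is added to its exchanged
    form: there both sums count [1] for a pair of positive increments and [1/2]
    for a pair with a single positive increment. *)
Lemma rho_reflected (y : R) : (0 <= y)%R ->
  rho mu y = average (fun k => if (y <= k%:R)%R then nu mu (k%:R - y) else 0).
Proof.
rewrite le_eqVlt => /predU1P[<-|y0].
  pose Q := average (fun k => nu mu k%:R).
  have rho0_ge0 : 0 <= rho mu 0 := rho_ge0 _ _.
  have w0 k j : 0 <= (nu_weight k%:R j)%:E by rewrite lee_fin nu_weight_ge0.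
  have QE : Q = average (fun k => average (fun j => (nu_weight k%:R j)%:E)).
    by apply: eq_average => k; rewrite nuE.
  have half0 k : 0 <= ((0 < k)%N%:R / 2)%R%:E :> \bar R.
    by rewrite lee_fin divr_ge0.
  have rhoL : rho mu 0 =
      average (fun k => average (fun=> ((0 < k)%N%:R / 2)%R%:E)).
    by rewrite rho0E; apply: eq_average => k; rewrite average_cst.
  have rhoR : rho mu 0 =
      average (fun=> average (fun j => ((0 < j)%N%:R / 2)%R%:E)).
    by rewrite average_cst -?rho0E.
  have QQ : Q + Q = rho mu 0 + rho mu 0.
    rewrite {2}QE (average_interchange w0) QE -averageD; last 2 first.
    - by move=> k; exact: average_ge0.
    - by move=> k; exact: average_ge0.
    rewrite {1}rhoL rhoR -averageD; last 2 first.
    - by move=> k; exact: average_ge0.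
    - by move=> k; exact: average_ge0.
    apply: eq_average => k; rewrite -!averageD//.
    apply: eq_average => j; rewrite -!EFinD; congr EFin.
    rewrite /nu_weight !pnatr_eq0 !ltr_nat !eqr_nat (eq_sym j k).
    by case: (posnP k) => k0; case: (posnP j) => j0;
      case: (ltngtP k j) => kj /=; try lra; lia.
  have -> : rho mu 0 = Q.
    have nu0_fin : rho mu 0 \is a fin_num.
      rewrite ge0_fin_numE//; apply: (@le_lt_trans _ _ 1); last exact: ltry.
      rewrite rho0E -[leRHS]average_cst//; apply: le_esum => k _.
      by rewrite lee_wpmul2r// lee_fin; case: (0 < k)%N => /=; lra.
    have Q_ge0 : 0 <= Q by apply: average_ge0 => k; exact: nu_ge0.
    have Q_fin : Q \is a fin_num.
      by move: QQ Q_ge0 nu0_fin; case: (Q) => // ; case: (rho mu 0).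
    move: QQ; rewrite -(fineK nu0_fin) -(fineK Q_fin) -!EFinD => -[QQ].
    congr EFin; lra.
  by apply: eq_average => k; rewrite ler0n subr0.
rewrite rhoE ?gt_eqF// average_interchange; last first.
  by move=> k j; rewrite lee_fin rho_weight_ge0.
apply: eq_average => j; have [yj|jy] := leP y j%:R; last first.
  rewrite /average esum1// => k _; rewrite /rho_weight.
  rewrite (lt_eqF jy) (lt_gtF jy)/= lt_eqF; last first.
    by rewrite (lt_le_trans jy)// lerDl.
  by rewrite mul0r !add0r; case: ifP => _; rewrite mul0e.
rewrite nuE; apply: eq_average => k; congr EFin.
rewrite /rho_weight /nu_weight subr_eq0.
have [<-|yNj] := eqVneq (j%:R : R) y.
  rewrite ltxx/= ; case: (posnP k) => [_|k0]; first by rewrite mul0r.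
  have -> : (j%:R == j%:R + k%:R :> R)%R = false.
    by rewrite lt_eqF// ltrDl ltr0n.
  by move=> /=; lra.
have ltyj : (y < j%:R)%R by rewrite lt_neqAle eq_sym yNj.
rewrite ltyj/= -[(k%:R == _)%R]/(k%:R == j%:R - y)%R.
rewrite (_ : (k%:R == j%:R - y)%R = (j%:R == y + k%:R)%R); last first.
  by rewrite eq_sym subr_eq addrC.
rewrite ltrBlDl; case: (posnP k) => [->|k0].
  by rewrite addr0 (negbTE yNj) ltNge (ltW ltyj)/=; lra.
lra.
Qed.

Lemma nu_le (x : R) : (0 <= x)%R -> nu mu x <= muR mu `[x, +oo[.
Proof.
move=> x0; rewrite nuE muR_average; apply: le_esum => j _.
rewrite lee_wpmul2r// lee_fin mem_setE in_itv/= andbT /nu_weight.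
case: ifP => [/eqP ->|_]; first by rewrite ler0n; case: (0 < j)%N => /=; lra.
by case: (ltgtP x j%:R) => _ /=; lra.
Qed.

Lemma nu_gt0 (x : R) k : (0 <= x <= k%:R)%R -> (0 < k)%N -> 0 < mu [set k] ->
  0 < nu mu x.
Proof.
move=> /andP[x0 xk] k0 muk; rewrite nuE.
apply: lt_le_trans (average_ge_elem _ k); rewrite mule_gt0// lte_fin.
rewrite /nu_weight k0; case: ifP => _; first by move=> /=; lra.
by case: (ltgtP x k%:R) xk => //= _ _; lra.
Qed.

End Weights.

(** * The state space *)

Section StateSpace.
Context (R : realType) (mu : probability nat R).
Hypothesis nonconstant : forall n, mu [set n] != 1%E.

Lemma supp_pos : exists2 k, supp mu k & (0 < k)%N.
Proof.
apply: contrapT => noex; have muk k : (0 < k)%N -> mu [set k] = 0%E.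
  move=> k0; apply/eqP/negPn/negP => muk; apply: noex; exists k => //.
  by rewrite /supp/= lt_def muk measure_ge0.
have /eqP := nonconstant 0; apply.
rewrite -[RHS](@probability_setT _ _ _ mu) -!average_indic.
apply: eq_esum => -[|k] _; last by rewrite muk// !mule0.
by rewrite in_setT mem_set.
Qed.

Lemma gcd_suppP e :
  (e %| gcd_set (supp mu))%N <-> (forall n, supp mu n -> (e %| n)%N).
Proof.
suff : [set g | forall e, (e %| g)%N <-> (forall n, supp mu n -> (e %| n)%N)]
    (gcd_set (supp mu)) by move/(_ e).
apply: getPex; have [k sk k0] := supp_pos.
pose common i := `[< forall n, supp mu n -> (i %| n)%N >].
(* Common divisors are at most [k]; their least common multiple is one too. *)
exists (\big[lcmn/1%N]_(i < k.+1 | common i) i) => i /=; split.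
  move=> ig n sn; apply: (dvdn_trans ig).
  by apply/dvdn_biglcmP => j /asboolP; apply.
move=> ci; have ik : (i < k.+1)%N by rewrite ltnS dvdn_leq// ci.
by apply: (@biglcmn_sup _ (Ordinal ik)) => //; exact/asboolP.
Qed.

Lemma gcd_supp_dvd n : supp mu n -> (gcd_set (supp mu) %| n)%N.
Proof. by move: n; apply/gcd_suppP. Qed.

Lemma gcd_supp_gt0 : (0 < gcd_set (supp mu))%N.
Proof.
by have [k /gcd_supp_dvd gk k0] := supp_pos; exact: dvdn_gt0 gk.
Qed.

Lemma S_class_shift (x0 x y : R) k : S_class mu x0 x -> supp mu k -> 0 <= y ->
  [\/ y = x + k%:R, y = x - k%:R | y = k%:R - x] -> S_class mu x0 y.
Proof.
move=> [_ [i xi]] /gcd_supp_dvd /dvdnP[q ->] y0 yx; split => //.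
have natz (z : int) : (z + q%:Z)%:~R = z%:~R + q%:R :> R by rewrite intrD.
case: xi yx => -> [] ->; rewrite natrM.
- by exists (i + q%:Z); left; rewrite natz; ring.
- by exists (i - q%:Z); left; rewrite intrB; ring.
- by exists (q%:Z - i); right; rewrite intrB; ring.
- by exists (i + q%:Z); right; rewrite natz; ring.
- by exists (i - q%:Z); right; rewrite intrB; ring.
- by exists (q%:Z - i); left; rewrite intrB; ring.
Qed.

Lemma supp_le_sup k (x : R) : supp mu k -> x <= k%:R ->
  (x%:E <= ereal_sup [set (n%:R : R)%:E | n in supp mu])%E.
Proof.
move=> sk xk; apply: (@le_trans _ _ (k%:R)%:E); first by rewrite lee_fin.
by apply: ereal_sup_ubound; exists k.
Qed.

Lemma C_class_ge0 (x0 x : R) : C_class mu x0 x -> 0 <= x.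
Proof. by move=> [[]]. Qed.

Lemma C_class_reflect (x0 x : R) k :
  C_class mu x0 x -> supp mu k -> x <= k%:R -> C_class mu x0 (k%:R - x).
Proof.
move=> [Sx _] sk xk; split.
  by apply: (S_class_shift Sx sk); [rewrite subr_ge0|constructor 3].
by apply: (supp_le_sup sk); rewrite gerBl; case: Sx.
Qed.

Lemma C_class_up (x0 x y : R) k : C_class mu x0 y -> C_class mu x0 x ->
  supp mu k -> y + k%:R <= x -> C_class mu x0 (y + k%:R).
Proof.
move=> [Sy _] [_ xN] sk yx; split; last exact: le_trans xN.
by apply: (S_class_shift Sy sk); [rewrite addr_ge0//; case: Sy|constructor 1].
Qed.

(** If the support is bounded, then its supremum is attained; otherwise its
    elements exceed every bound. *)
Lemma C_class_supp_ge (x0 x : R) : C_class mu x0 x ->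
  exists k, [/\ supp mu k, (0 < k)%N & x <= k%:R].
Proof.
move=> [_ xN]; apply: contrapT => noex; have [m sm m0] := supp_pos.
have lt_x k : supp mu k -> (0 < k)%N -> k%:R < x.
  by move=> sk k0; rewrite ltNge; apply/negP => xk; apply: noex; exists k.
have x0' : 0 < x by apply: lt_trans (lt_x _ sm m0); rewrite ltr0n.
have ex_s : exists k, `[< supp mu k >] by exists m; exact/asboolP.
have s_le k : `[< supp mu k >] -> (k <= Num.truncn x)%N.
  move=> /asboolP sk; rewrite truncn_ge_nat ?(ltW x0')//.
  by case: (posnP k) => [->|/(lt_x _ sk)/ltW//]; exact: ltW.
have [M /asboolP sM Mmax] := ex_maxnP ex_s s_le.
have Mx : M%:R < x.
  by apply: lt_x => //; apply: (leq_trans m0); exact/Mmax/asboolP.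
move: Mx; apply/negP; rewrite -leNgt -lee_fin (le_trans xN)//.
apply: ge_ereal_sup => _ [k sk <-]; rewrite lee_fin ler_nat.
exact/Mmax/asboolP.
Qed.

(** The remainder of [x0] modulo the gcd [g] is less than [g], which is at most any
    positive element of the support. *)
Lemma C_class_nonempty (x0 : R) : exists x, C_class mu x0 x.
Proof.
have [k sk k0] := supp_pos; set g : R := (gcd_set (supp mu))%:R.
have g0 : 0 < g by rewrite ltr0n gcd_supp_gt0.
have gk : g <= k%:R by rewrite ler_nat dvdn_leq// gcd_supp_dvd.
pose m := Num.floor (x0 / g).
have m1 : m%:~R * g <= x0 by rewrite -ler_pdivlMr// floor_le.
have m2 : x0 < (m + 1)%:~R * g by rewrite -ltr_pdivrMr// floorD1_gt.
exists (x0 - m%:~R * g); split; last first.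
  apply: (supp_le_sup sk); rewrite (le_trans _ gk)//.
  by move: m2; rewrite intrD mulrDl mul1r; lra.
split; first by rewrite subr_ge0.
by exists (- m); left; rewrite mulrNz mulNr addrC.
Qed.

Lemma C_class_countable (x0 : R) : countable (C_class mu x0).
Proof.
pose g : R := (gcd_set (supp mu))%:R.
pose e (p : int * bool) : R := p.1%:~R * g + (-1) ^+ p.2 * x0.
apply: (@sub_countable _ _ _ (range e)); last first.
  by apply: (sub_countable (card_image_le _ _)); exact: countableP.
apply: subset_card_le => x [[_ [i [->|->]]] _].
  by exists (i, false); rewrite // /e mul1r.
by exists (i, true); rewrite // /e/= expr1 mulN1r.
Qed.

End StateSpace.

(** * The one-step kernels *)

Section Kernels.
Context (R : realType) (mu : probability nat R).
Hypothesis nonconstant : forall n, mu [set n] != 1%E.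
Variable x0 : R.
Local Notation C := (C_class mu x0).
Local Open Scope ereal_scope.

Definition descent (x y : R) : \bar R :=
  if (0 < y)%R then muR mu [set (x - y)%R] else 0.

Definition reflection (x y : R) : \bar R := muR mu [set (x + y)%R].

Lemma descent_ge0 x y : 0 <= descent x y.
Proof. by rewrite /descent; case: ifP => // _; exact: measure_ge0. Qed.

Lemma reflection_ge0 x y : 0 <= reflection x y.
Proof. exact: measure_ge0. Qed.

Lemma muR_neq0 t : muR mu [set t] != 0 -> exists k, t = k%:R.
Proof.
move=> mut; apply: contrapT => noex; move/eqP: mut; apply.
rewrite /muR (_ : [set n | _] = set0) ?measure0//.
by apply/seteqP; split => // n /= nt; apply: noex; exists n.
Qed.

Lemma act_descent (f : R -> \bar R) (y : R) : (0 < y)%R ->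
  act C f descent y =
  \esum_(k in [set k | C (y + k%:R)%R]) (f (y + k%:R)%R * mu [set k]).
Proof.
move=> y0; rewrite /act (@esum_along _ _ (fun k => y + k%:R)%R).
- apply: eq_esum => k _; rewrite /descent y0.
  by rewrite /= (_ : y + k%:R - y = k%:R)%R ?muR_natr//; ring.
- by move=> i j /addrI/eqP; rewrite eqr_nat => /eqP.
- move=> x _; rewrite /descent y0 mule_eq0 negb_or => /andP[_ /muR_neq0[k xk]].
  by exists k; rewrite -xk addrC subrK.
Qed.

Lemma act_reflection (f : R -> \bar R) (y : R) :
  act C f reflection y =
  \esum_(k in [set k | C (k%:R - y)%R]) (f (k%:R - y)%R * mu [set k]).
Proof.
rewrite /act (@esum_along _ _ (fun k => k%:R - y)%R).
- by apply: eq_esum => k _; rewrite /reflection subrK muR_natr.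
- by move=> i j /addIr/eqP; rewrite eqr_nat => /eqP.
- move=> x _; rewrite mule_eq0 negb_or => /andP[_ /muR_neq0[k xk]].
  by exists k; rewrite -xk addrK.
Qed.

Lemma suppP k : mu [set k] = 0 \/ supp mu k.
Proof.
have [->|muk] := eqVneq (mu [set k]) 0; [by left|right].
by rewrite /supp/= lt_def muk measure_ge0.
Qed.

Lemma nu_supp_ge (x : R) : (0 <= x)%R -> nu mu x != 0 ->
  exists2 k, supp mu k & (x <= k%:R)%R.
Proof.
move=> x_ge0 nux; apply: contrapT => noex; move/eqP: nux; apply.
apply/eqP; rewrite eq_le nu_ge0 andbT (le_trans (nu_le _ x_ge0))//.
rewrite muR_average /average esum1// => k _.
have [->|sk] := suppP k; first by rewrite mule0.
rewrite mem_setE in_itv/= andbT; case: leP; last by rewrite mul0e.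
by move=> xk; exfalso; apply: noex; exists k.
Qed.

Lemma nu_balance y : C y -> nu mu y = rho mu y + act C (nu mu) descent y.
Proof.
move=> Cy; have := C_class_ge0 Cy; rewrite le_eqVlt => /predU1P[<-|y0].
  rewrite /act esum1 ?adde0; last by move=> x _; rewrite /descent ltxx mule0.
  by rewrite /nu /rho eqxx.
rewrite nu_rho_balance// act_descent//; congr (_ + _).
rewrite [RHS]esum_mkcond; apply: eq_esum => k _.
case: ifPn => // /negP nC; have [->|sk] := suppP k; first by rewrite mule0.
have [->|] := eqVneq (nu mu (y + k%:R)) 0; first by rewrite mul0e.
have yk0 : (0 <= y + k%:R)%R by rewrite addr_ge0// ltW.
case/(nu_supp_ge yk0) => j sj ykj; case: nC; apply: mem_set; split.
  by apply: (S_class_shift nonconstant Cy.1 sk) => //; constructor 1.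
exact: (supp_le_sup sj).
Qed.

Lemma rho_act_reflection y : C y -> rho mu y = act C (nu mu) reflection y.
Proof.
move=> Cy; rewrite rho_reflected ?(C_class_ge0 Cy)// act_reflection.
rewrite [RHS]esum_mkcond; apply: eq_esum => k _.
have [->|sk] := suppP k; first by rewrite !mule0; case: ifP.
case: ifPn => [yk|/negP yk].
  by rewrite ifT//; apply: mem_set; exact: C_class_reflect.
rewrite ifF ?mul0e//; apply/negP => /set_mem /C_class_ge0.
by rewrite subr_ge0.
Qed.

Lemma nu_fin y : C y -> nu mu y < +oo.
Proof.
move=> Cy; rewrite (le_lt_trans (nu_le _ (C_class_ge0 Cy)))//.
by rewrite (le_lt_trans (probability_le1 _ _))// ltry.
Qed.

Lemma nu_pos y : C y -> 0 < nu mu y.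
Proof.
move=> Cy; have [k [sk k0 yk]] := C_class_supp_ge nonconstant Cy.
by apply: (nu_gt0 _ k0) => //; rewrite (C_class_ge0 Cy).
Qed.

(** This is what makes a mass function [g] on [C] finite at [x] as soon as its
    image by [reflection] is finite. *)
Lemma reflection_pos x : C x -> exists2 y, C y & 0 < reflection x y.
Proof.
move=> Cx; have [k [sk k0 xk]] := C_class_supp_ge nonconstant Cx.
exists (k%:R - x)%R; first exact: C_class_reflect.
by rewrite /reflection addrC subrK muR_natr.
Qed.

End Kernels.

(** * The excursions between reflections *)

Section Excursions.
Context d (Omega : measurableType d) (R : realType) (P : probability Omega R).
Variables (Y : nat -> {RV P >-> nat}) (mu : probability nat R).
Hypothesis Yiid : iid Y mu.
Hypothesis nonconstant : forall n, mu [set n] != 1%E.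
Variable x0 : R.
Local Notation C := (C_class mu x0).
Local Notation psum := (psum Y).
Local Open Scope ereal_scope.

Lemma measurable_psumR n (A : set R) : measurable [set w | A (psum n w)%:R].
Proof. exact: (measurable_psum Y n [set k | A k%:R]). Qed.

(** The states visited between [x] and [y] are of the form [y + k <= x], hence
    in [C]: restricting the sums to [C] loses no path. *)
Lemma power_descent n x y : C x -> C y ->
  power C (descent mu) n x y =
  if (n == 0)%N || (0 < y)%R
  then P [set w | (psum n w)%:R = x - y :> R]%R else 0.
Proof.
move=> Cx; elim: n y => [|n IHn] y Cy /=.
  have [<-|/eqP xy] := eqVneq x y.
    rewrite (_ : [set w | _] = setT) ?probability_setT//.
    by apply/seteqP; split => // w _ /=; rewrite subrr /psum big_ord0.
  rewrite (_ : [set w | _] = set0) ?measure0//.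
  apply/seteqP; split => // w /=; rewrite /psum big_ord0 => /esym/eqP.
  by rewrite subr_eq0 => /eqP.
case: ifPn => y0; last first.
  by rewrite /compose esum1// => z _; rewrite /descent (negbTE y0) mule0.
rewrite -[LHS]/(act C (power C (descent mu) n x) (descent mu) y) act_descent//.
transitivity (P [set w | (psum n w)%:R = x - y - (Y n w)%:R :> R]%R); last first.
  congr (P _); apply/seteqP; split => w /=.
    by rewrite psumS natrD => ->; rewrite subrK.
  by rewrite psumS natrD => <-; rewrite addrK.
rewrite (psum_increment_law Yiid n (fun j m => m%:R = x - y - j%:R :> R)%R).
rewrite esum_mkcond; apply: eq_esum => k _.
have [->|sk] := suppP mu k; first by rewrite !mule0; case: ifP.
case: ifPn => [/set_mem Cyk|/negP nC].
  by rewrite IHn// ltr_wpDr ?orbT// opprD addrA.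
rewrite (_ : [set w | _] = set0) ?measure0 ?mul0e//.
apply/seteqP; split => // w /= xyk; apply: nC; apply: mem_set.
apply: (C_class_up nonconstant Cy Cx sk); rewrite -subr_ge0 opprD addrA -xyk.
exact: ler0n.
Qed.

(** The last state before the reflection is [k - y], where [k] is the reflecting
    increment. It is positive unless no descent has been made: the chain may
    start at [0], from where every step counts as a reflection. *)
Lemma power_reflection n x y : C x -> C y ->
  compose C (power C (descent mu) n) (reflection mu) x y =
  P [set w | (n = 0%N \/ (psum n w)%:R < x) /\ (psum n.+1 w)%:R = x + y]%R.
Proof.
move=> Cx Cy.
have x_ge0 := C_class_ge0 Cx; have y_ge0 := C_class_ge0 Cy.
rewrite -[LHS]/(act C (power C (descent mu) n x) (reflection mu) y).
rewrite act_reflection.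
transitivity (P [set w | (n = 0%N \/ (psum n w)%:R < x) /\
    (psum n w)%:R + (Y n w)%:R = x + y]%R); last first.
  by congr (P _); apply/seteqP; split => w /=; rewrite psumS natrD.
rewrite (psum_increment_law Yiid n
  (fun j m => (n = 0%N \/ m%:R < x) /\ m%:R + j%:R = x + y)%R).
rewrite esum_mkcond; apply: eq_esum => k _.
have [->|sk] := suppP mu k; first by rewrite !mule0; case: ifP.
case: ifPn => [/set_mem Cky|/negP nC].
  congr (_ * _); rewrite power_descent//; have ky := C_class_ge0 Cky.
  case: ifPn => [n0|].
    congr (P _); apply/seteqP; split => w /=; last by move=> [_ ?]; lra.
    move=> S; split; last by lra.
    by case/orP: n0 => [/eqP ->|?]; [left|right; lra].
  rewrite negb_or => /andP[/eqP n0 yk]; rewrite (_ : [set w | _] = set0).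
    by rewrite measure0.
  apply/seteqP; split => // w /= [[//|Sx] S]; move: yk; rewrite -leNgt; lra.
have ky : (k%:R < y)%R.
  rewrite ltNge; apply/negP => yk; apply: nC; apply: mem_set.
  exact: C_class_reflect.
rewrite (_ : [set w | _] = set0) ?measure0 ?mul0e//.
apply/seteqP; split => // w /= [[n0|Sx] S]; last by lra.
by move: S; rewrite n0 /psum big_ord0; lra.
Qed.

Lemma walk_before_reflection x n w : ((psum n w)%:R <= x)%R ->
  walk Y x n w = (x - (psum n w)%:R)%R.
Proof.
elim: n => [|n IHn]; first by rewrite /psum big_ord0 subr0.
rewrite psumS natrD => Sx /=.
have Y0 : (0 <= (Y n w)%:R :> R)%R by exact: ler0n.
by rewrite IHn ?ger0_norm; lra.
Qed.

Lemma reflectionP x n w : ((psum n w)%:R <= x)%R ->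
  walk Y x n.+1 w = (- (walk Y x n w - (Y n w)%:R))%R <->
  (x <= (psum n.+1 w)%:R)%R.
Proof.
move=> Sx /=; rewrite walk_before_reflection// psumS natrD.
split => [|xS]; last by rewrite ler0_norm; lra.
move=> E; have : (0 <= `|x - (psum n w)%:R - (Y n w)%:R|)%R by [].
by rewrite E; lra.
Qed.

Lemma inf_nat_eq (A : set nat) n : A n -> (forall m, A m -> (n <= m)%N) ->
  inf_nat A = n.
Proof.
move=> An nA; have [Ai iA] : [set n | A n /\ forall m, A m -> (n <= m)%N] (inf_nat A).
  by apply: getPex; exists n.
by apply/eqP; rewrite eqn_leq iA// nA.
Qed.

Lemma first_reflection x n w : (n = 0%N \/ (psum n w)%:R < x)%R -> (0 <= x)%R ->
  (x <= (psum n.+1 w)%:R)%R -> reflections Y x 1 w = ((psum n.+1 w)%:R - x)%R.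
Proof.
move=> nSx x_ge0 xS.
have Snx : ((psum n w)%:R <= x)%R.
  by case: nSx => [->|/ltW//]; rewrite /psum big_ord0.
have timeE : reflection_time Y x 1 w = n.+1.
  apply: inf_nat_eq => /=; first by split => //; exact/reflectionP.
  case=> [[]//|m [_ refl_m]]; rewrite leqNgt; apply/negP => mn.
  have {}mn : (m < n)%N by lia.
  have Sm1 : ((psum m.+1 w)%:R <= (psum n w)%:R :> R)%R.
    by rewrite ler_nat; exact: psum_homo.
  have Sm : ((psum m w)%:R <= x)%R.
    by rewrite (le_trans _ Snx)// ler_nat; apply: psum_homo; exact: ltnW.
  move/(reflectionP Sm): refl_m; case: nSx => [n0|]; last by lra.
  by rewrite n0 in mn.
rewrite /reflections timeE; have /(reflectionP Snx) -> := xS.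
by rewrite walk_before_reflection// psumS natrD; lra.
Qed.

Lemma no_reflection x w : (forall n, (psum n.+1 w)%:R < x)%R ->
  reflections Y x 1 w = x.
Proof.
move=> Sx; rewrite /reflections /= /inf_nat getPN// => m [[m0 refl_m] _].
case: m m0 refl_m => // m _ /reflectionP H.
have Sm : ((psum m w)%:R <= x)%R.
  by rewrite ltW// (le_lt_trans _ (Sx m))// ler_nat; exact: psum_homo.
by have := H Sm; have := Sx m; lra.
Qed.

Definition first_reflection_event n (x y : R) : set Omega :=
  [set w | (n = 0%N \/ (psum n w)%:R < x) /\ (psum n.+1 w)%:R = x + y]%R.

Lemma reflections1_event x y : (0 <= x)%R -> (0 <= y)%R ->
  [set w | reflections Y x 1 w = y] =
  \bigcup_n first_reflection_event n x y `|`
    ([set w | forall n, ((psum n.+1 w)%:R < x)%R] `&` [set w | x = y]).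
Proof.
move=> x_ge0 y_ge0; apply/seteqP; split => w /=; last first.
  case=> [[n _ [nSx S]]|[Sx xy]]; last by rewrite no_reflection.
  by rewrite (first_reflection nSx)// S; lra.
have [Sx|] := pselect (forall n, (psum n.+1 w)%:R < x)%R.
  by rewrite no_reflection// => xy; right.
move=> /existsNP ex; have {}ex : exists n, (x <= (psum n.+1 w)%:R)%R.
  by case: ex => n /negP; rewrite -leNgt => ?; exists n.
have [n xS nmin] := ex_minnP ex.
have nSx : (n = 0%N \/ (psum n w)%:R < x)%R.
  case: n xS nmin => [|n] _ nmin; [by left|right].
  by rewrite ltNge; apply/negP => /nmin; rewrite ltnn.
by rewrite (first_reflection nSx)// => <-; left; exists n => //; split => //; lra.
Qed.

Lemma measurable_first_reflection n x y :
  measurable (first_reflection_event n x y).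
Proof.
rewrite (_ : first_reflection_event n x y =
    [set w | (n = 0%N \/ (psum n w)%:R < x)%R] `&`
    [set w | (psum n.+1 w)%:R = x + y]%R)//.
apply: measurableI; first exact: (measurable_psumR n [set s | n = 0%N \/ s < x]%R).
exact: (measurable_psumR n.+1 [set s | s = x + y]%R).
Qed.

(** The chain is almost surely reflected, and the number of steps without
    reflection before the first one counts the powers of [descent]. *)
Lemma transition_reflections x y : C x -> C y ->
  transition P (reflections Y) x y = watched C (descent mu) (reflection mu) x y.
Proof.
move=> Cx Cy; have x_ge0 := C_class_ge0 Cx; have y_ge0 := C_class_ge0 Cy.
have mN : measurable [set w | forall n, ((psum n.+1 w)%:R < x)%R].
  rewrite (_ : [set w | _] = \bigcap_n [set w | ((psum n.+1 w)%:R < x)%R]).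
    apply: bigcapT_measurable => n.
    exact: (measurable_psumR n.+1 [set s | s < x]%R).
  by apply/seteqP; split => w H n; [move=> _; exact: (H n)|exact: (H n I)].
have PN : P [set w | forall n, ((psum n.+1 w)%:R < x)%R] = 0.
  apply/eqP; rewrite eq_le measure_ge0 andbT.
  rewrite -(psum_bounded_null Yiid (Num.truncn x) (nonconstant 0%N)).
  have mB : measurable [set w | forall n, (psum n w <= Num.truncn x)%N].
    rewrite (_ : [set w | _] = \bigcap_n [set w | (psum n w <= Num.truncn x)%N]).
      apply: bigcapT_measurable => n.
      exact: (measurable_psum Y n [set k | (k <= Num.truncn x)%N]).
    by apply/seteqP; split => w H n; [move=> _; exact: (H n)|exact: (H n I)].
  apply: le_measure; rewrite ?inE// => w H n.
  rewrite truncn_ge_nat// ltW// (le_lt_trans _ (H n))// ler_nat.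
  exact: psum_homo.
have xyE : [set w : Omega | x = y] = setT \/ [set w : Omega | x = y] = set0.
  by have [xy|xy] := pselect (x = y); [left|right]; apply/seteqP; split.
rewrite /transition reflections1_event// measureU0//; last 3 first.
- by apply: bigcupT_measurable => n; exact: measurable_first_reflection.
- by case: xyE => ->; rewrite ?setIT ?setI0.
- by case: xyE => ->; rewrite ?setIT ?setI0 ?measure0.
rewrite measure_bigcup//; last 2 first.
- by move=> n _; exact: measurable_first_reflection.
- apply: ltn_trivIset => n m nm; rewrite -subset0 => w [[_ S] [mSx _]].
  have : ((psum m.+1 w)%:R <= (psum n w)%:R :> R)%R.
    by rewrite ler_nat; exact: psum_homo.
  by case: mSx => [m0|]; [rewrite m0 in nm|lra].
rewrite nneseries_esum// set_mem_set; apply: eq_esum => n _.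
by rewrite power_reflection.
Qed.

Lemma transition_walk x y : C x -> C y ->
  transition P (walk Y) x y = descent mu x y + reflection mu x y.
Proof.
move=> Cx Cy; have x_ge0 := C_class_ge0 Cx; have y_ge0 := C_class_ge0 Cy.
have law t : muR mu [set t] = P [set w | (Y 0%N w)%:R = t :> R].
  by rewrite /muR -(increment_law Yiid 0).
have mY t : measurable [set w | (Y 0%N w)%:R = t :> R].
  exact: (measurable_increment Y 0 [set n | n%:R = t]).
rewrite /transition /descent /reflection !law.
case: ifPn => y0; last first.
  have -> : y = 0%R by apply/eqP; rewrite eq_le y_ge0 leNgt y0.
  rewrite addr0 add0e; congr (P _); apply/seteqP; split => w /=.
    by move/eqP; rewrite normr_eq0 subr_eq0 => /eqP.
  by move=> ->; rewrite subrr normr0.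
rewrite -measureU//; last first.
  by rewrite -subset0 => w /= []; lra.
congr (P _); apply/seteqP; split => w /=.
  by case: ger0P => _ E; [left|right]; lra.
by case=> ->; [rewrite ger0_norm|rewrite ler0_norm]; lra.
Qed.

(** [nu x] is at most the probability that an increment reaches [x]. So the mass
    brought to [y] by [n > 0] descents is at most the probability that [Y n] is
    at least the sum of the previous increments. Either this sum is at most [K],
    or [Y n] exceeds [K]; both are unlikely for a large [K] and then a large
    [n]. *)
Lemma nu_descent_vanishes y (e : R) : C y -> (0 < e)%R ->
  exists n, act C (nu mu) (power C (descent mu) n) y <= e%:E.
Proof.
move=> Cy e0; have e20 : (0 < e / 2)%R by rewrite divr_gt0.
have [K muK] : exists K, mu [set k | (K < k)%N] <= (e / 2)%R%:E.
  pose F K := [set k | (K < k)%N].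
  have cvgF : mu (F K) @[K --> \oo] --> 0.
    rewrite -(measure0 mu) -(_ : \bigcap_K F K = set0).
      apply: nonincreasing_cvg_mu => //.
        by rewrite (le_lt_trans (probability_le1 _ _))// ltry.
      by move=> i j ij; apply/subsetPset => k; exact: leq_ltn_trans.
    by apply/seteqP; split => // k /(_ k I); rewrite /F/= ltnn.
  have [N _ HN] : \forall K \near \oo, mu (F K) < (e / 2)%R%:E.
    by apply: (cvgF [set x | x < (e / 2)%R%:E]); exact: (@nbhs_open_ereal_lt _ 0%R (fun=> (e / 2)%R)).
  by exists N; apply/ltW; apply: HN; exact: leqnn.
have [n Pn] := psum_small_prob Yiid K (nonconstant 0%N) e20.
exists n.+1; rewrite (_ : e%:E = (e / 2)%R%:E + (e / 2)%R%:E); last first.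
  by rewrite -EFinD -splitr.
rewrite (le_trans _ (leeD (ltW Pn) muK))//.
have [y0|y0] := ltP 0%R y; last first.
  rewrite /act esum1 ?adde_ge0// => x Cx.
  by rewrite power_descent//= ltNge y0/= mule0.
rewrite -(increment_law Yiid n.+1).
have mE1 : measurable [set w | (psum n.+1 w <= K)%N].
  exact: (measurable_psum Y n.+1 [set k | (k <= K)%N]).
have mE2 : measurable [set w | (K < Y n.+1 w)%N].
  exact: (measurable_increment Y n.+1 [set k | (K < k)%N]).
pose E k := [set w | psum n.+1 w = k] `&` [set w | (k <= Y n.+1 w)%N].
have mE k : measurable (E k).
  apply: measurableI; first exact: (measurable_psum Y n.+1 [set k]).
  exact: (measurable_increment Y n.+1 [set j | (k <= j)%N]).
apply: (@le_trans _ _ (P (\bigcup_k E k))); last first.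
  apply: (@le_trans _ _ (P ([set w | (psum n.+1 w <= K)%N] `|`
                            [set w | (K < Y n.+1 w)%N]))); last first.
    exact: measureU2.
  apply: le_measure; rewrite ?inE//.
  - exact: bigcupT_measurable.
  - exact: measurableU.
  move=> w [k _ [/= <- SY]].
  by have [SK|KS] := leqP (psum n.+1 w) K; [left|right; exact: leq_trans SY].
rewrite measure_bigcup//; last by move=> i j _ _ [w [[/= <- _] [/= <- _]]].
rewrite nneseries_esum// set_mem_set /act.
rewrite (@esum_along _ _ (fun k => y + k%:R)%R); last 2 first.
- by move=> i j /addrI/eqP; rewrite eqr_nat => /eqP.
- move=> x Cx; rewrite power_descent// y0 orbT mule_eq0 negb_or => /andP[_ Pxy].
  apply: contrapT => noex; move/eqP: Pxy; apply.
  rewrite (_ : [set w | _] = set0) ?measure0//; apply/seteqP; split => // w /= S.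
  by apply: noex; exists (psum n.+1 w); rewrite S; ring.
rewrite esum_mkcond; apply: le_esum => k _; case: ifPn => [/set_mem Cyk|_].
  have /= -> := power_descent n.+1 Cyk Cy; rewrite y0 muleC.
  rewrite (_ : [set w | _] = [set w | psum n.+1 w = k]); last first.
    apply/seteqP; split => w /=; last by move=> ->; ring.
    move=> S; apply/eqP; rewrite -(eqr_nat R) S; apply/eqP; ring.
  rewrite (psum_increment_indep Yiid n.+1 [set k] [set j | (k <= j)%N]).
  apply: lee_wpmul2l; first exact: measure_ge0.
  rewrite (le_trans (nu_le _ (C_class_ge0 Cyk)))// /muR.
  apply: le_measure; rewrite ?inE// => j /=.
  rewrite in_itv/= andbT -(ler_nat R); lra.
exact: measure_ge0.
Qed.

End Excursions.

(** * Invariant measures *)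

Section DenumerableMeasures.
Context (R : realType).
Local Open Scope ereal_scope.

(** The injection [enc] into the naturals cuts [D] into a sequence of sets with
    at most one point. *)
Lemma measure_countable_esum (m : {measure set R -> \bar R}) (D : set R) :
  countable D -> m D = \esum_(x in D) m [set x].
Proof.
move=> /countable_injP[enc enc_inj].
pose F n := D `&` [set x | enc x = n].
have DE : D = \bigcup_n F n.
  by apply/seteqP; split => [x Dx|x [n _ []]//]; exists (enc x).
have F_small n : F n = set0 \/ exists x, F n = [set x].
  have [F0|/set0P[x Fx]] := eqVneq (F n) set0; [by left|right; exists x].
  apply/seteqP; split => [z [Dz zn]|_ ->//]; case: Fx => Dx xn.
  by apply: enc_inj; rewrite ?inE//= zn xn.
have tF : trivIset [set: nat] F by move=> i j _ _ [x [[_ /= <-] [_ /= <-]]].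
rewrite [in LHS]DE measure_bigcup//; last first.
  by move=> n _; case: (F_small n) => [->|[x ->]].
rewrite [in RHS]DE nneseries_sum_bigcup//.
rewrite nneseries_esum// set_mem_set nneseries_esumT; last first.
  by move=> n; exact: esum_ge0.
apply: eq_esum => n _; case: (F_small n) => [->|[x ->]].
  by rewrite measure0 esum_set0.
by rewrite esum_set1.
Qed.

Lemma concentrated_measure_esum (m : {measure set R -> \bar R}) (C B : set R) :
  countable C -> m (~` C) = 0 -> measurable B ->
  m B = \esum_(x in B `&` C) m [set x].
Proof.
move=> cC mC mB; have mesC : measurable C by exact: countable_measurable.
rewrite -measure_countable_esum; last exact: sub_countable (subset_card_le (@subIsetr _ _ _)) cC.
rewrite -{1}(setIT B) -(setUv C) setIUr measureU0//.
- exact: measurableI.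
- by apply: measurableI => //; exact: measurableC.
apply/eqP; rewrite eq_le measure_ge0 andbT -mC.
have mCc := measurableC mesC.
by apply: le_measure; rewrite ?inE//; exact: measurableI.
Qed.

Section SumMeasure.
Variables (C : set R) (f : R -> \bar R) (f_ge0 : forall x, 0 <= f x).
Let m : {measure set R -> \bar R} := sum_measure C f_ge0.

Lemma sum_measure_set1 x : C x -> m [set x] = f x.
Proof.
move=> Cx; rewrite /m/= /sum_measure (_ : [set x] `&` C = [set x]).
  by rewrite esum_set1.
by apply/seteqP; split => [y []//|y ->].
Qed.

Lemma sum_measureC : m (~` C) = 0.
Proof. by rewrite /m/= /sum_measure setICl esum_set0. Qed.

Lemma sum_measure_total : m C = \esum_(x in C) f x.
Proof. by rewrite /m/= /sum_measure setIid. Qed.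

End SumMeasure.

End DenumerableMeasures.

Section InvariantMeasures.
Context d (Omega : measurableType d) (R : realType) (P : probability Omega R).
Variables (Y : nat -> {RV P >-> nat}) (mu : probability nat R).
Hypothesis Yiid : iid Y mu.
Hypothesis nonconstant : forall n, mu [set n] != 1%E.
Variable x0 : R.
Local Notation C := (C_class mu x0).
Local Notation a := (descent mu).
Local Notation b := (reflection mu).
Local Open Scope ereal_scope.

Let a_ge0 := @descent_ge0 R mu.
Let b_ge0 := @reflection_ge0 R mu.

(** Iterating the balance between [nu] and [rho] downwards shows that [nu] is
    the potential of [rho]: [nu x] is the expected time spent at [x] before the
    next reflection, weighted by [rho] over the starting points. *)
Lemma nu_potential y : C y -> potential C a (rho mu) y = nu mu y.
Proof.
move=> Cy; apply: potential_unique => //.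
- exact: nu_ge0.
- exact: rho_ge0.
- by move=> x Cx; exact: nu_balance.
- by move=> e e0; exact: (nu_descent_vanishes Yiid nonconstant).
Qed.

Lemma act_reflections (f : R -> \bar R) y : (forall x, 0 <= f x) -> C y ->
  \esum_(x in C) (f x * transition P (reflections Y) x y) =
  act C (potential C a f) b y.
Proof.
move=> f0 Cy; rewrite -act_watched//; apply: eq_esum => x Cx.
by rewrite (transition_reflections Yiid nonconstant Cx Cy).
Qed.

Lemma act_walk (f : R -> \bar R) y : (forall x, 0 <= f x) -> C y ->
  \esum_(x in C) (f x * transition P (walk Y) x y) =
  act C f a y + act C f b y.
Proof.
move=> f0 Cy; rewrite -esumD; last 2 first.
- by move=> x _; exact: mule_ge0.
- by move=> x _; exact: mule_ge0.
apply: eq_esum => x Cx; rewrite -ge0_muleDr//.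
by rewrite (transition_walk Yiid Cx Cy).
Qed.

Lemma rho_invariant : invariant_measure P (reflections Y) C (rho_ mu x0).
Proof.
split.
- exact: sum_measureC.
- have [x Cx] := C_class_nonempty nonconstant x0.
  have [y Cy bxy] := reflection_pos nonconstant Cx.
  rewrite gt_eqF// sum_measure_total.
  apply: lt_le_trans (ge_esum_elem _ Cy).
  rewrite (rho_act_reflection nonconstant Cy) /act.
  apply: lt_le_trans (ge_esum_elem _ Cx).
  by rewrite mule_gt0// (nu_pos nonconstant Cx).
- move=> y Cy; rewrite sum_measure_set1//.
  apply: le_lt_trans (nu_fin Cy); rewrite (nu_balance nonconstant Cy) leeDl//.
  by apply: act_ge0 => // x; exact: nu_ge0.
- move=> y Cy; rewrite sum_measure_set1//.
  rewrite (eq_esum (b := fun x => rho mu x * transition P (reflections Y) x y)).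
    rewrite act_reflections//; last exact: rho_ge0.
    rewrite (rho_act_reflection nonconstant Cy); apply: eq_act => x Cx.
    by rewrite nu_potential.
  by move=> x Cx; rewrite sum_measure_set1.
Qed.

(** The spread of an invariant measure [f] of the reflection chain over the
    excursions that follow is the potential [g] of [f]. It satisfies
    [g = f + act C g a] by construction and [f = act C g b] by the invariance of
    [f], so that it is invariant for the walk. *)
Section Spread.
Variable m : {measure set R -> \bar R}.
Hypothesis m_inv : invariant_measure P (reflections Y) C m.

Let f x := m [set x].
Let g := potential C a f.

Let f_ge0 x : 0 <= f x. Proof. exact: measure_ge0. Qed.

Definition spread_ge0 x : 0 <= g x := potential_ge0 C a_ge0 x f_ge0.

Lemma spread_reflection y : C y -> act C g b y = f y.
Proof. by move=> Cy; case: m_inv => _ _ _ /(_ y Cy); rewrite act_reflections. Qed.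

Lemma spread_invariant :
  invariant_measure P (walk Y) C (sum_measure C spread_ge0).
Proof.
have gE x : C x -> g x = f x + act C g a x by move=> Cx; exact: potential_rec.
case: m_inv => mC mN0 m_fin m_eq; split.
- exact: sum_measureC.
- rewrite gt_eqF// (lt_le_trans (y := m C))//.
    by rewrite lt_def mN0 measure_ge0.
  rewrite sum_measure_total measure_countable_esum; last exact: C_class_countable.
  apply: le_esum => x Cx; rewrite gE// leeDl// act_ge0// => z.
  exact: spread_ge0.
- move=> x Cx; rewrite sum_measure_set1//.
  have [y Cy bxy] := reflection_pos nonconstant Cx.
  rewrite ltey; apply/eqP => gx; have := m_fin y Cy.
  rewrite -/(f y) -spread_reflection// ltNge => /negP; apply.
  rewrite (le_trans _ (ge_esum_elem _ Cx))// gx gt0_mulye//.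
- move=> y Cy; rewrite sum_measure_set1//.
  rewrite (eq_esum (b := fun x => g x * transition P (walk Y) x y)).
    rewrite act_walk//; last exact: spread_ge0.
    by rewrite gE// spread_reflection// addeC.
  by move=> x Cx; rewrite sum_measure_set1.
Qed.

(** An invariant measure of the reflection chain is recovered from its spread
    measure by taking one reflection step. *)
Lemma spread_proportional (c : R) : (0 < c)%R ->
  (forall x, C x -> g x = c%:E * nu mu x) ->
  forall B, measurable B -> m B = c%:E * rho_ mu x0 B.
Proof.
move=> c0 gE B mB; case: m_inv => mC _ _ _.
rewrite (concentrated_measure_esum (C_class_countable mu x0) mC mB).
rewrite -[rho_ mu x0 B]/(\esum_(x in B `&` C) rho mu x).
rewrite -esumZl ?lee_fin ?(ltW c0)//; last exact: rho_ge0.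
apply: eq_esum => y [_ Cy]; rewrite -/(f y) -spread_reflection//.
rewrite (rho_act_reflection nonconstant Cy) /act -esumZl ?lee_fin ?(ltW c0)//.
  by apply: eq_esum => x Cx; rewrite gE// muleA.
by move=> x; rewrite mule_ge0// nu_ge0.
Qed.

End Spread.
End InvariantMeasures.

Theorem mainTheorem1 (d : measure_display) (Omega : measurableType d)
    (R : realType) (P : probability Omega R) (Y : nat -> {RV P >-> nat})
    (mu : probability nat R) (x0 : R)
    (Yiid : iid Y mu)
    (Ync : forall n : nat, mu [set n] != 1%E)
    (x0_ge0 : 0 <= x0) :
  invariant_measure P (reflections Y) (C_class mu x0) (rho_ mu x0) /\
  (unique_invariant_measure P (walk Y) (C_class mu x0) (nu_ mu x0) ->
   unique_invariant_measure P (reflections Y) (C_class mu x0) (rho_ mu x0)).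
Proof.
have rho_inv := rho_invariant Yiid Ync x0; split => // -[_ nu_unique].
split => // m m_inv.
have [c c0 cE] := nu_unique _ (spread_invariant Yiid Ync m_inv).
exists c => //; apply: (spread_proportional Yiid Ync m_inv c0) => x Cx.
by have := cE [set x] (measurable_set1 x); rewrite !sum_measure_set1.
Qed.
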